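(* Let $d\ge 1$ and $m_1,\dots,m_d$ be positive integers, and let $G$ be the $d$-dimensional cylindrical grid $Q^{\mathrm{Cyl}}_{2m_1,\dots,2m_d}=C_{2m_1}\square P_{2m_2}\square\cdots\square P_{2m_d}$, with vertex set $\prod_{i=1}^d[2m_i]$, carrying the boustrophedon labelling, and let $\mathcal{O}$ be the orientation directing every edge from its lower-labelled endpoint to its higher-labelled endpoint. Give every vertex weight $x$ and every edge along the $q$-th coordinate direction weight $a_q$ ($1\le q\le d$). Then the partition function of the monopole-dimer (loop-vertex) model on $(G,\mathcal{O})$ is $$\mathcal{Z}^{\mathrm{Cyl}}_{2m_1,\dots,2m_d}=\prod_{i_1=1}^{m_1}\cdots\prod_{i_d=1}^{m_d}\Big(x^2+4a_1^2\sin^2\frac{(2i_1-1)\pi}{2m_1}+\sum_{q=2}^{d}4a_q^2\cos^2\frac{i_q\pi}{2m_q+1}\Big)^{2^{d-1}}.$$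
   Context: $P_n$ is the path on vertices $1,\dots,n$ and $C_n$ the cycle on $1,\dots,n$ (with the extra edge $\{1,n\}$). The Cartesian product $G_1\square\cdots\square G_k$ has vertex set $V(G_1)\times\cdots\times V(G_k)$, two vertices being adjacent iff they differ in exactly one coordinate $i$ and those $i$-th coordinates are adjacent in $G_i$; such an edge is ''along the $i$-th coordinate direction''. Boustrophedon labelling of a grid with side lengths $n_1,\dots,n_d$: for $d=1$ vertex $p$ gets label $p$; for $d>1$, with $N=n_1\cdots n_{d-1}$ and $L_{d-1}$ the labelling of the $(d-1)$-dimensional grid, vertex $(v_1,\dots,v_d)$ gets label $(v_d-1)N+L_{d-1}(v_1,\dots,v_{d-1})$ if $v_d$ is odd and $(v_d-1)N+N+1-L_{d-1}(v_1,\dots,v_{d-1})$ if $v_d$ is even. Loop-vertex (monopole-dimer) model on an oriented graph $(G,\mathcal{O})$ with vertex weights $x(v)$ and edge weights $a_{v,v'}=a_{v',v}$: $\mathrm{sgn}(v,v')=1$ if $v\to v'$ in $\mathcal{O}$ and $-1$ if $v'\to v$. A configuration is a collection of vertex-disjoint directed cycles of even length $\ge4$ (the two directions of a cycle giving different configurations), doubled edges (loops of length 2), and isolated vertices, such that every vertex lies in exactly one loop or is isolated. A loop $(v_0,v_1,\dots,v_{2k}=v_0)$ has weight $-\prod_{i=0}^{2k-1}\mathrm{sgn}(v_i,v_{i+1})a_{v_i,v_{i+1}}$ (so a doubled edge $\{u,v\}$ has weight $a_{u,v}^2$); a configuration has weight the product of its loop weights and of $x(v)$ over isolated vertices $v$.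 The partition function is the sum of the weights of all configurations.
   Formalization: For m_1 = 1 the cycle C_2 is read as two parallel edges whose pair of vertices carries total weight 2a_1 (with a single edge of weight a_1 the formula fails: x^2+a_1^2 versus x^2+4a_1^2 for d=1); for m_1 ≥ 2 nothing is changed. *)

(* Defs.v *)
From mathcomp Require Import all_boot all_order all_algebra.
From mathcomp Require Import boolp.

Set Implicit Arguments.
Unset Strict Implicit.
Unset Printing Implicit Defensive.

Import GRing.Theory.
Local Open Scope ring_scope.

(* The loop-vertex (monopole-dimer) model on a graph with vertex set T,
   adjacency relation adj and orientation arr (arr u v means u -> v), with
   vertex weights x and edge weights a. *)
Section LoopVertexModel.
Variables (T : finType) (R : comPzRingType).
Variables (adj arr : rel T) (x : T -> R) (a : T -> T -> R).

Definition sgn (u v : T) : R := if arr u v then 1 else -1.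

Definition arcs (c : seq T) : {set T * T} := [set (v, next c v) | v in c].

(* A loop is recorded as its set of arcs. Hence a closed walk does not depend
   on its starting point, the two directions of a cycle of length at least 4
   are different loops, and a doubled edge {u, v} is the single loop
   {(u, v), (v, u)} of length 2. *)
Definition is_loop (L : {set T * T}) : Prop :=
  exists c : seq T,
    [/\ (2 <= size c)%N, ~~ odd (size c), uniq c, cycle adj c & L = arcs c].

Definition loop_vertices (L : {set T * T}) : {set T} := [set e.1 | e in L].

(* The isolated vertices of a configuration are those lying in none of its
   loops. *)
Definition is_config (F : {set {set T * T}}) : Prop :=
  (forall L, L \in F -> is_loop L) /\
  (forall L L', L \in F -> L' \in F -> L != L' ->
     [disjoint loop_vertices L & loop_vertices L']).

Definition loop_weight (L : {set T * T}) : R :=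
  - \prod_(e in L) (sgn e.1 e.2 * a e.1 e.2).

Definition config_weight (F : {set {set T * T}}) : R :=
  (\prod_(L in F) loop_weight L) *
  (\prod_(v | [forall L in F, v \notin loop_vertices L]) x v).

Definition partition_function : R :=
  \sum_(F : {set {set T * T}} | `[< is_config F >]) config_weight F.

End LoopVertexModel.

(* Vertices of the path and cycle on n vertices are the elements p of 'I_n,
   standing for the vertex p + 1. Both graphs are given by the number of edges
   joining two vertices: C_n is P_n with one more edge joining 1 and n, so C_2
   has two parallel edges, and all other multiplicities are 0 or 1 for n >= 2. *)
Definition path_edges (n : nat) (p p' : 'I_n) : nat :=
  ((p.+1 == p' :> nat) || (p'.+1 == p :> nat)).

Definition cycle_edges (n : nat) (p p' : 'I_n) : nat :=
  (path_edges p p' +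
   (((p == 0 :> nat) && (p' == n.-1 :> nat)) ||
    ((p' == 0 :> nat) && (p == n.-1 :> nat))))%N.

Section CartesianProduct.
Variables (I : finType) (V : I -> finType) (edges : forall i, V i -> V i -> nat).

Definition box_edges (i : I) (u v : {dffun forall i, V i}) : nat :=
  if (u i != v i) && [forall j, (j != i) ==> (u j == v j)]
  then edges (u i) (v i) else 0%N.

Definition box_adj : rel {dffun forall i, V i} :=
  fun u v => [exists i, (0 < box_edges i u v)%N].

(* The weight joining u and v when each edge along direction i has weight a i.
   For fixed u and v at most one i contributes. Since sgn depends only on
   endpoints, giving a pair the total weight of its parallel edges amounts to
   letting each step of a loop use any one of them. *)
Definition box_weight (R : nmodType) (a : I -> R)
    (u v : {dffun forall i, V i}) : R :=
  \sum_i a i *+ box_edges i u v.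

End CartesianProduct.

(* n i is the (i+1)-st side length and v i the (i+1)-st coordinate, the latter
   being counted from 1; only the first d values matter, and d = 0 is junk. *)
Fixpoint boustrophedon (n v : nat -> nat) (d : nat) : nat :=
  match d with
  | 0 => 0%N
  | 1 => v 0%N
  | (d'.+1 as k).+1 =>
      let N := (\prod_(i < k) n i)%N in
      let L := boustrophedon n v k in
      if odd (v k) then ((v k - 1) * N + L)%N
      else ((v k - 1) * N + N + 1 - L)%N
  end.

Section CylindricalGrid.
Variables (d : nat) (m : 'I_d -> nat).

Definition grid : finType := {dffun forall q : 'I_d, 'I_(2 * m q)}.

Definition extend0 (f : 'I_d -> nat) (i : nat) : nat := oapp f 0%N (insub i).

Definition label (v : grid) : nat :=
  boustrophedon (extend0 (fun q => 2 * m q)%N) (extend0 (fun q => (v q).+1)) d.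

Definition cyl_edges (q : 'I_d) : 'I_(2 * m q) -> 'I_(2 * m q) -> nat :=
  if q == 0%N :> nat then @cycle_edges (2 * m q) else @path_edges (2 * m q).

Definition cyl_adj : rel grid := box_adj cyl_edges.

Definition cyl_arr : rel grid :=
  fun u v => cyl_adj u v && (label u < label v)%N.

Definition cyl_partition_function (R : comPzRingType) (x : R) (a : 'I_d -> R)
    : R :=
  partition_function cyl_adj cyl_arr (fun=> x) (box_weight cyl_edges a).

End CylindricalGrid.

(* Main.v *)
Require Import Defs.
From mathcomp Require Import all_boot all_order all_algebra all_fingroup.
From mathcomp Require Import boolp reals trigo.
From mathcomp Require Import ring lra zify.

Set Implicit Arguments.
Unset Strict Implicit.
Unset Printing Implicit Defensive.

Import Order.TTheory GRing.Theory Num.Theory.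
Local Open Scope ring_scope.

(** The grid is bipartite, so the permutations contributing to the determinant
    of its signed weighted adjacency matrix K (with x on the diagonal) have only
    even cycles and fixed points; they are exactly the configurations, with the
    right signs, and the partition function is det K.

    For the boustrophedon orientation the sign of an edge along direction q is
    governed by the parity of the sum of the later coordinates, so
    K = x + A with A = sum_q a_q M_q and M_q = 1 (x) .. (x) T_q (x) J (x) .. (x) J
    where T_q is the oriented adjacency matrix of the q-th factor and
    J = diag(1, -1, 1, ..). Since J T_q = - T_q J, the M_q anticommute, whence
    A^2 = sum_q a_q^2 M_q^2 is diagonalised by tensor products of local
    eigenvectors of T_q^2. As A is antisymmetric, char_poly A = char_poly (- A),
    so (char_poly A)^2 = det ('X^2 - A^2), which is the square of the claimed
    product in x because the local spectra are invariant under reversing the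
    index; both square roots are monic, hence equal. *)

(** * Tensor products and anticommuting sums *)

(** Dependent functions are transported to [fprod], where they are functions into a tagged union, so
    that distributivity for non-dependent functions applies. *)
Lemma big_distr_dffun (R : comPzRingType) (I : finType) (V : I -> finType)
    (F : forall i, V i -> R) :
  \sum_(f : {dffun forall i, V i}) \prod_i F i (f i) = \prod_i \sum_(p : V i) F i p.
Proof.
rewrite (reindex (@dffun_of_fprod _ V)); last exact/onW_bij/dffun_of_fprod_bij.
transitivity (\sum_(g : fprod V) \prod_i F i (g i)).
  by apply: eq_bigr => g _; apply: eq_bigr => i _; rewrite ffunE.
rewrite (eq_bigr (fun g : fprod V => \prod_(i in I) finfun (F i) (g i))); last first.
  by move=> g _; apply: eq_bigr => i _; rewrite ffunE.
rewrite big_fprod.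
rewrite -(bigA_distr_big_dep (fun i => tagged_with V i) (fun i => untag 0 (finfun (F i)))).
apply: eq_bigr => i _.
rewrite -(big_tag (fun i => finfun (F i)) i).
by apply: eq_bigr => p _; rewrite ffunE.
Qed.

Lemma dffun_neqP (I : finType) (V : I -> finType) (f g : {dffun forall i, V i}) :
  f != g -> exists i, f i != g i.
Proof.
move=> fg; apply/existsP; apply: contraR fg; rewrite negb_exists => /forallP e.
by apply/eqP/ffunP => i; apply/eqP; have := e i; rewrite negbK.
Qed.

Section TensorProduct.
Variables (R : comPzRingType) (I : finType) (n : I -> nat).
Local Notation T := {dffun forall i, 'I_(n i)}.
Implicit Types (A B : forall i, 'M[R]_(n i)).

(** Kronecker product of a family of square matrices of varying sizes. Multi-indices are numbered
    through [enum_val], so that determinants and characteristic polynomials make sense. *)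
Definition tens A : 'M[R]_#|{: T}| :=
  \matrix_(u, v) \prod_i A i ((enum_val u : T) i) ((enum_val v : T) i).

Lemma eq_tens A B : (forall i, A i = B i) -> tens A = tens B.
Proof.
move=> e; apply/matrixP => u v; rewrite !mxE.
by apply: eq_bigr => i _; rewrite e.
Qed.

Lemma tens_mul A B : tens A *m tens B = tens (fun i => A i *m B i).
Proof.
apply/matrixP => u v; rewrite !mxE.
transitivity (\sum_(w : T) \prod_i (A i ((enum_val u : T) i) (w i) *
    B i (w i) ((enum_val v : T) i))).
  rewrite [RHS](reindex _ (onW_bij _ (@enum_val_bij T))) /=.
  by apply: eq_bigr => w _; rewrite !mxE big_split.
rewrite (big_distr_dffun (fun i p => A i ((enum_val u : T) i) p * B i p ((enum_val v : T) i))).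
by apply: eq_bigr => i _; rewrite mxE.
Qed.

Lemma tens_diag (D : forall i, 'rV[R]_(n i)) :
  tens (fun i => diag_mx (D i)) =
  diag_mx (\row_u \prod_i D i 0 ((enum_val u : T) i)).
Proof.
apply/matrixP => u v; rewrite !mxE; have [<-|uv] := eqVneq u v.
  by rewrite mulr1n; apply: eq_bigr => i _; rewrite mxE eqxx mulr1n.
have /dffun_neqP[i ui] : enum_val u != enum_val v by rewrite (inj_eq enum_val_inj).
by rewrite (bigD1 i) //= mxE (negPf ui) mul0r.
Qed.

Lemma tens1 : tens (fun i => 1%:M) = 1%:M.
Proof.
rewrite (@eq_tens _ (fun i => diag_mx (const_mx 1))) ?tens_diag => [|i];
  last by rewrite diag_const_mx.
rewrite -diag_const_mx; congr diag_mx; apply/rowP => u; rewrite !mxE.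
by apply: big1 => i _; rewrite mxE.
Qed.

Lemma tens_tr A : (tens A)^T = tens (fun i => (A i)^T).
Proof. by apply/matrixP => u v; rewrite !mxE; apply: eq_bigr => i _; rewrite mxE. Qed.

Lemma tens_opp A B q : B q = - A q -> (forall i, i != q -> B i = A i) ->
  tens B = - tens A.
Proof.
move=> Bq Bi; apply/matrixP => u v; rewrite !mxE (bigD1 q) //= Bq mxE mulNr.
congr (- _); rewrite [RHS](bigD1 q) //=; congr (_ * _).
by apply: eq_bigr => i iq; rewrite Bi.
Qed.
End TensorProduct.

Lemma sum_anticomm_sqr (R : comPzRingType) n d (X : 'I_d -> 'M[R]_n) :
  (forall q r : 'I_d, (q < r)%N -> X q *m X r = - (X r *m X q)) ->
  (\sum_q X q) *m (\sum_q X q) = \sum_q X q *m X q.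
Proof.
move=> anti; rewrite mulmx_suml.
under eq_bigr => q _ do
  rewrite mulmx_sumr (bigD1 q) //= (bigID (fun r : 'I_d => (r < q)%N)) /=.
rewrite big_split big_split /= -[RHS]addr0; congr (_ + _).
(* Both halves of the off-diagonal sum are put over the same pairs [r < q], where they cancel term
   by term. *)
rewrite [X in X + _](_ : _ = \sum_(r < d) \sum_(q < d | (r < q)%N) X q *m X r); last first.
  rewrite (exchange_big_dep predT) //=; apply: eq_bigr => r _; apply: eq_bigl => q.
  by rewrite -val_eqE /=; lia.
rewrite [X in _ + X](_ : _ = \sum_(r < d) \sum_(q < d | (r < q)%N) X r *m X q); last first.
  apply: eq_bigr => r _; apply: eq_bigl => q.
  by rewrite -val_eqE /=; lia.
rewrite -big_split big1 // => r _ /=; rewrite -big_split big1 // => q rq /=.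
by rewrite (anti r q rq) subrr.
Qed.

(** * Anticommuting tensor strings and the characteristic polynomial of their sum *)

Section CliffordSum.
Variables (R : idomainType) (d : nat) (n : 'I_d -> nat).
Variables (T J : forall q, 'M[R]_(n q)) (a : 'I_d -> R).
Hypothesis J2 : forall q, J q *m J q = 1%:M.
Hypothesis JT : forall q, J q *m T q = - (T q *m J q).
Hypothesis trJ : forall q, (J q)^T = J q.
Hypothesis trT : forall q, (T q)^T = - T q.
Local Notation V := {dffun forall q, 'I_(n q)}.

(** A Jordan-Wigner string: the factors [J] behind position [q] will carry the sign by which later
    coordinates reverse the labels. *)
Definition tail_factor (q r : 'I_d) : 'M[R]_(n r) :=
  if (r < q)%N then 1%:M else if r == q then T r else J r.

Definition tail_tens (q : 'I_d) := tens (tail_factor q).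

Definition tail_sum := \sum_q a q *: tail_tens q.

Lemma tail_tens_sqr q : tail_tens q *m tail_tens q =
  tens (fun r => if r == q then T r *m T r else 1%:M).
Proof.
rewrite tens_mul; apply: eq_tens => r; rewrite /tail_factor.
by case: ltngtP => [rq|qr|/val_inj->]; rewrite ?eqxx ?(gtn_eqF rq)
  ?mulmx1 -?val_eqE ?(gtn_eqF qr) ?(ltn_eqF rq) //= (gtn_eqF qr).
Qed.

(** The two strings commute in every factor except the one at [r], where [J r] meets [T r]. *)
Lemma tail_tens_anticomm (q r : 'I_d) : (q < r)%N ->
  tail_tens q *m tail_tens r = - (tail_tens r *m tail_tens q).
Proof.
move=> qr; rewrite !tens_mul; apply: (@tens_opp _ _ _ _ _ r).
  by rewrite /tail_factor ltnn eqxx ltnNge ltnW //= gt_eqF //= JT.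
move=> i ir; rewrite /tail_factor.
case: (ltngtP i r) => [i_r|ri|/val_inj]; last 1 first.
- by move=> e; rewrite e eqxx in ir.
- by rewrite mulmx1 mul1mx.
by rewrite ltnNge (ltnW (ltn_trans qr ri)) /= -!val_eqE /= !gtn_eqF // (ltn_trans qr ri).
Qed.

Lemma tr_tail_sum : tail_sum^T = - tail_sum.
Proof.
rewrite /tail_sum raddf_sum -sumrN; apply: eq_bigr => q _ /=.
rewrite linearZ /= -scalerN; congr (_ *: _); rewrite tens_tr.
apply: (@tens_opp _ _ _ _ _ q).
  by rewrite /tail_factor ltnn eqxx trT.
by move=> r rq; rewrite /tail_factor (negPf rq); case: ifP; rewrite ?trmx1 ?trJ.
Qed.

Variables (Phi : forall q, 'M[R]_(n q)) (lam : forall q, 'rV[R]_(n q)).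
Hypothesis Phi_unit : forall q, Phi q \in unitmx.
Hypothesis Phi_eigen : forall q,
  T q *m T q *m Phi q = - (Phi q *m diag_mx (lam q)).

(** The eigenvalues of [- tail_sum *m tail_sum]. Diagonalising only the squares of the antisymmetric
    [T q] avoids imaginary eigenvalues. *)
Definition tail_eigenvalue (u : V) : R := \sum_q a q ^+ 2 * lam q 0 (u q).

Lemma tens_unit : tens Phi \in unitmx.
Proof.
have /mulmx1_unit[] // : tens Phi *m tens (fun q => invmx (Phi q)) = 1%:M.
by rewrite tens_mul -tens1; apply: eq_tens => q; rewrite mulmxV.
Qed.

(** By anticommutation only the squares survive, and each of them acts on a single tensor factor, so
    tensors of local eigenvectors are common eigenvectors. *)
Lemma tail_sum_sqr_eigen : tail_sum *m tail_sum *m tens Phi =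
  - (tens Phi *m diag_mx (\row_(u < #|{: V}|) tail_eigenvalue (enum_val u))).
Proof.
rewrite sum_anticomm_sqr => [|q r qr]; last first.
  by rewrite -!scalemxAl -!scalemxAr tail_tens_anticomm // !scalerN !scalerA mulrC.
rewrite mulmx_suml.
have -> : diag_mx (\row_(u < #|{: V}|) tail_eigenvalue (enum_val u)) =
  \sum_q (a q ^+ 2 *: tens (fun r => if r == q then diag_mx (lam r) else 1%:M)).
  transitivity (\sum_q a q ^+2 *: diag_mx (\row_(u < #|{: V}|) lam q 0 ((enum_val u : V) q))).
    apply/matrixP => u v; rewrite summxE !mxE -sumrMnl; apply: eq_bigr => q _.
    by rewrite !mxE mulrnAr.
  apply: eq_bigr => q _; congr (_ *: _).
  rewrite (@eq_tens _ _ _ _ (fun r => diag_mx (if r == q then lam r else const_mx 1))).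
    rewrite tens_diag; congr diag_mx; apply/rowP => u; rewrite !mxE (bigD1 q) //= eqxx.
    by rewrite big1 ?mulr1 // => r /negPf->; rewrite mxE.
  by move=> r; case: eqP => // _; rewrite diag_const_mx.
rewrite mulmx_sumr -sumrN; apply: eq_bigr => q _.
rewrite -scalemxAl -scalemxAr scalerA -expr2 -scalemxAl -scalemxAr -scalerN; congr (_ *: _).
rewrite tail_tens_sqr !tens_mul; apply: (@tens_opp _ _ _ _ _ q).
  by rewrite eqxx Phi_eigen.
by move=> r /negPf ->; rewrite mulmx1 mul1mx.
Qed.

Lemma char_poly_opp_tail_sum : char_poly (- tail_sum) = char_poly tail_sum.
Proof.
rewrite -tr_tail_sum /char_poly -det_tr; congr (\det _).
by apply/matrixP => u v; rewrite !mxE eq_sym.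
Qed.

Lemma char_poly_tail_sum_sqr : char_poly tail_sum ^+ 2 =
  \prod_(u : V) ('X^2 + (tail_eigenvalue u)%:P).
Proof.
rewrite expr2 -{2}char_poly_opp_tail_sum -det_mulmx /char_poly_mx.
set A := tail_sum; set P := map_mx polyC (tens Phi).
(* With M = (X - A)(X + A), the relation M P = P D gives det M = det D once the unit det P is
   cancelled. *)
have uP : \det P \is a GRing.unit.
  by rewrite det_map_mx rmorph_unit // -unitmxE tens_unit.
apply: (mulIr uP); rewrite -det_mulmx.
set D := \row_(u < #|{: V}|) ('X^2 + (tail_eigenvalue (enum_val u))%:P).
have -> : ('X%:M - map_mx polyC A) *m ('X%:M - map_mx polyC (- A)) *m P = P *m diag_mx D.
  have -> : ('X%:M - map_mx polyC A) *m ('X%:M - map_mx polyC (- A)) =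
     'X^2%:M - map_mx polyC (A *m A).
    rewrite map_mxN opprK mulmxDr !mulmxDl !mulNmx map_mxM expr2 scalar_mxM.
    by rewrite -[X in _ + (X - _)]scalar_mxC addrA addrNK.
  rewrite mulmxDl mulNmx -map_mxM tail_sum_sqr_eigen map_mxN opprK map_mxM.
  rewrite -scalar_mxC -mulmxDr; congr (_ *m _).
  apply/matrixP => u v; rewrite !mxE; case: eqP => [->|_].
    by rewrite !mulr1n.
  by rewrite !mulr0n addr0.
rewrite det_mulmx mulrC; congr (_ * _).
rewrite det_diag [RHS](reindex _ (onW_bij _ (@enum_val_bij V))) /=.
by apply: eq_bigr => u _; rewrite mxE.
Qed.

Lemma det_tail_sum (x : R) (Q : {poly R}) : Q \is monic ->
  \prod_(u : V) ('X^2 + (tail_eigenvalue u)%:P) = Q ^+ 2 ->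
  \det (x%:M + tail_sum) = Q.[x].
Proof.
move=> mQ eQ.
have <- : char_poly tail_sum = Q.
  have /eqP : char_poly tail_sum ^+ 2 = Q ^+ 2 by rewrite char_poly_tail_sum_sqr.
  rewrite eqf_sqr => /orP[/eqP //|/eqP e].
  (* The case of opposite sign is not refuted: leading coefficients give 1 = - 1 in [R], whence - Q
     = Q. *)
  have := congr1 lead_coef e.
  rewrite lead_coefN (eqP mQ) (eqP (char_poly_monic _)) e => e1.
  by rewrite -[Q in LHS]mul1r -mulNr -(rmorph1 polyC) -rmorphN -e1 mul1r.
rewrite -char_poly_opp_tail_sum -horner_evalE -det_map_mx; congr (\det _).
apply/matrixP => u v; rewrite !mxE /= /horner_eval.
by rewrite hornerD hornerMn hornerX hornerN hornerC opprK.
Qed.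

End CliffordSum.

(** * Spectra of the oriented path and cycle *)

Section LocalMatrices.
Variable R : realType.
Implicit Types (n k : nat) (t c : R).

Lemma sum_delta n k (f : nat -> R) :
  \sum_(p < n) (p == k :> nat)%:R * f p = (k < n)%N%:R * f k.
Proof.
case: ltnP => [kn|nk].
  rewrite (bigD1 (Ordinal kn)) //= eqxx big1 ?addr0 // => i.
  by rewrite -val_eqE /= => /negPf ->; rewrite mul0r.
rewrite mul0r big1 // => i _; case: eqP => [ik|_]; last by rewrite mul0r.
by move: (ltn_ord i); rewrite ik ltnNge nk.
Qed.

(** Each term telescopes through 2 sin t cos y = sin (y + t) - sin (y - t). *)
Lemma sum_cos_telescope n c t :
  2 * sin t * \sum_(p < n) cos (c + p%:R * (2 * t)) =
  sin (c - t + (2 * t) * n%:R) - sin (c - t).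
Proof.
elim: n => [|n IH]; first by rewrite big_ord0 !mulr0 addr0 subrr.
rewrite big_ord_recr /= mulrDr IH -[n.+1%:R]natr1.
set y := c + n%:R * (2 * t).
have -> : c - t + 2 * t * n%:R = y - t by rewrite /y; ring.
have -> : c - t + 2 * t * (n%:R + 1) = y + t by rewrite /y; ring.
rewrite (sinB y) (sinD y); ring.
Qed.

Lemma sum_cos_period n k c t : t * n%:R = k%:R * pi -> sin t != 0 ->
  \sum_(p < n) cos (c + p%:R * (2 * t)) = 0.
Proof.
move=> tn st; have := sum_cos_telescope n c t.
have -> : 2 * t * n%:R = (pi *+ 2) *+ k.
  by rewrite -mulrA tn -[_ *+ k]mulr_natl -[pi *+ 2]mulr_natl; ring.
rewrite (periodicn (@sinD2pi R)) subrr => /eqP.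
by rewrite !mulf_eq0 pnatr_eq0 (negPf st) /= => /eqP.
Qed.

Lemma sin_natmul n t : sin t = 0 -> sin (n%:R * t) = 0.
Proof.
move=> st; elim: n => [|n IH]; first by rewrite mul0r sin0.
by rewrite -natr1 mulrDl mul1r sinD IH st mulr0 mul0r addr0.
Qed.

Lemma sum_sin_period n k t : t * n%:R = k%:R * pi ->
  \sum_(p < n) sin (p%:R * (2 * t)) = 0.
Proof.
move=> tn; have [st|st] := eqVneq (sin t) 0.
  by rewrite big1 // => p _; rewrite sin_natmul // mulr_natl sin_mulr2n st mulr0 mul0rn.
rewrite -[RHS](sum_cos_period (- (pi / 2)) tn st).
by apply: eq_bigr => p _; rewrite addrC cosBpihalf.
Qed.

(** Oriented adjacency matrix with edges directed upwards; multiplicities count, so the double edge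
    of C_2 gives an entry 2. *)
Definition skew_mx n (e : 'I_n -> 'I_n -> nat) : 'M[R]_n :=
  \matrix_(p, p') ((if (p < p')%N then 1 else -1) *+ e p p').

Definition alt_mx n : 'M[R]_n := diag_mx (\row_p (-1) ^+ p).

Lemma skew_mx_path n (p p' : 'I_n) :
  skew_mx (@path_edges n) p p' = (p' == p.+1 :> nat)%:R - (p == p'.+1 :> nat)%:R.
Proof.
rewrite mxE /path_edges; case: ltnP => h.
  rewrite [p == _ :> nat](_ : _ = false); last by apply/negbTE; lia.
  by rewrite [_ == p :> nat](_ : _ = false) ?orbF ?subr0 1?eq_sym //; lia.
rewrite [p' == _ :> nat](_ : _ = false); last by apply/negbTE; lia.
rewrite [_ == p' :> nat](_ : _ = false) //=; last by apply/negbTE; lia.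
by rewrite eq_sym mulNrn sub0r.
Qed.

Lemma skew_mx_cycle n (p p' : 'I_n) : (1 < n)%N ->
  skew_mx (@cycle_edges n) p p' = skew_mx (@path_edges n) p p' +
   (((p == 0 :> nat) && (p' == n.-1 :> nat))%:R -
    ((p' == 0 :> nat) && (p == n.-1 :> nat))%:R).
Proof.
move=> n1; rewrite !mxE /cycle_edges mulrnDr; congr (_ + _).
case: ltnP => h.
  rewrite [X in _ || X](_ : _ = false) ?orbF; last by apply/negbTE; lia.
  by rewrite [X in _ - X%:R](_ : _ = 0%N) ?subr0 //; lia.
rewrite [X in X || _](_ : _ = false) /=; last by apply/negbTE; lia.
by rewrite [X in X%:R - _](_ : _ = 0%N) ?sub0r ?mulNrn //; lia.
Qed.

Lemma sum_skew_path n (f : nat -> R) (p : 'I_n) :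
  \sum_p' skew_mx (@path_edges n) p p' * f p' =
  (p.+1 < n)%N%:R * f p.+1 - (0 < p)%N%:R * f p.-1.
Proof.
under eq_bigr do rewrite skew_mx_path mulrBl.
rewrite sumrB sum_delta; congr (_ - _).
case: (posnP p) => [p0|p0].
  by rewrite mul0r big1 // => i _; rewrite p0 mul0r.
have pn : (p.-1 < n)%N by have := ltn_ord p; lia.
rewrite mul1r; have := sum_delta n p.-1 f; rewrite pn mul1r => <-.
by apply: eq_bigr => i _; congr (_%:R * _); apply/eqP/eqP; lia.
Qed.

(** Antiperiodicity makes the last row look like an interior one, since the wrap-around term [- f 0]
    equals [f n]. Indices being natural numbers, the first row keeps [f n.-1] in place of minus the
    value at -1. *)
Lemma sum_skew_cycle n (f : nat -> R) (p : 'I_n) : (1 < n)%N ->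
  f n = - f 0%N ->
  \sum_p' skew_mx (@cycle_edges n) p p' * f p' =
  f p.+1 + (p == 0 :> nat)%:R * f n.-1 - (0 < p)%N%:R * f p.-1.
Proof.
move=> n1 fn; under eq_bigr do rewrite skew_mx_cycle // mulrDl mulrBl.
rewrite big_split /= sum_skew_path sumrB.
have -> : \sum_(i < n) ((p == 0 :> nat) && (i == n.-1 :> nat))%:R * f i =
   (p == 0 :> nat)%:R * f n.-1.
  case: (p == 0 :> nat) => /=; last by rewrite mul0r big1 // => i _; rewrite mul0r.
  by rewrite sum_delta (_ : (n.-1 < n)%N) //; lia.
have -> : \sum_(i < n) ((i == 0 :> nat) && (p == n.-1 :> nat))%:R * f i =
   (p == n.-1 :> nat)%:R * f 0%N.
  case: (p == n.-1 :> nat) => /=.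
    under eq_bigr do rewrite andbT.
    by rewrite sum_delta (_ : (0 < n)%N) //; lia.
  by rewrite mul0r big1 // => i _; rewrite andbF mul0r.
have : (p == n.-1 :> nat)%:R * f 0%N = (p.+1 < n)%N%:R * f p.+1 - f p.+1.
  case: eqP => pn.
    have -> : p.+1 = n by lia.
    by rewrite ltnn fn mul1r mul0r sub0r opprK.
  by rewrite (_ : (p.+1 < n)%N) ?mul1r ?mul0r ?subrr //; have := ltn_ord p; lia.
by move=> ->; ring.
Qed.

Lemma sin_frac_neq0 (k n : nat) : (0 < k < n)%N -> sin (k%:R * pi / n%:R) != 0 :> R.
Proof.
case/andP=> k0 kn; have n0 : 0 < n%:R :> R by rewrite ltr0n; lia.
rewrite gt_eqF // sin_gt0_pi //; apply/andP; split.
  by rewrite divr_gt0 // mulr_gt0 ?pi_gt0 // ltr0n.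
by rewrite ltr_pdivrMr // mulrC ltr_pM2l ?pi_gt0 // ltr_nat.
Qed.

Lemma sinDnpi t k : sin (t + k%:R * pi) = (-1) ^+ k * sin t.
Proof.
elim: k => [|k IH]; first by rewrite mul0r addr0 mul1r.
rewrite -[k.+1%:R]natr1 mulrDl mul1r addrA sinDpi IH exprS; ring.
Qed.

(** Telescoping with t = k pi / (2 n) leaves (1 - (-1)^k) sin t; the bound on [k] makes sin t
    nonzero. *)
Lemma sum_cos_half n k : (0 < k < 2 * n)%N ->
  \sum_(p < n) cos (p%:R * (k%:R * pi / n%:R)) = (1 - (-1) ^+ k) / 2 :> R.
Proof.
move=> hk; have := sin_frac_neq0 hk; set t := _ / _ => st.
have n0 : n%:R != 0 :> R by rewrite pnatr_eq0; lia.
have e : k%:R * pi / n%:R = 2 * t :> R by rewrite /t natrM; field.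
apply: (mulfI (_ : 2 * sin t != 0)); first by rewrite mulf_neq0 ?pnatr_eq0.
rewrite e; under eq_bigr do rewrite -[_ * (2 * t)]add0r.
rewrite sum_cos_telescope -e divfK // sinDnpi sub0r sinN; by field.
Qed.


(** Products become half-differences of cosine sums of frequencies j - k and j + k. These have the
    same parity, so the sums agree unless j = k. *)
Lemma sum_sin_orth n j k : (0 < j < n)%N -> (0 < k < n)%N ->
  \sum_(p < n) sin (p%:R * (j%:R * pi / n%:R)) * sin (p%:R * (k%:R * pi / n%:R)) =
  (n%:R / 2) *+ (j == k) :> R.
Proof.
wlog lekj : j k / (k <= j)%N => [hw hj hk|].
  have [/hw->//|/ltnW/hw h] := leqP k j.
  by rewrite eq_sym -h //; apply: eq_bigr => p _; rewrite mulrC.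
move=> hj hk.
have -> : \sum_(p < n) sin (p%:R * (j%:R * pi / n%:R)) * sin (p%:R * (k%:R * pi / n%:R)) =
   2^-1 * \sum_(p < n) cos (p%:R * ((j - k)%N%:R * pi / n%:R)) -
   2^-1 * \sum_(p < n) cos (p%:R * ((j + k)%N%:R * pi / n%:R)) :> R.
  rewrite !mulr_sumr -sumrB; apply: eq_bigr => p _.
  have -> : p%:R * ((j - k)%N%:R * pi / n%:R) =
     p%:R * (j%:R * pi / n%:R) - p%:R * (k%:R * pi / n%:R) :> R by rewrite natrB //; ring.
  have -> : p%:R * ((j + k)%N%:R * pi / n%:R) =
     p%:R * (j%:R * pi / n%:R) + p%:R * (k%:R * pi / n%:R) :> R by rewrite natrD //; ring.
  by rewrite cosB cosD; field.
have [->|jk] := eqVneq j k.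
  rewrite (@sum_cos_half n (k + k)) ?subnn; last by lia.
  rewrite addnn -mul2n exprM sqrrN !expr1n subrr !mul0r mulr0 subr0.
  under eq_bigr do rewrite mulr0 cos0.
  by rewrite sumr_const card_ord mulrC.
rewrite !sum_cos_half; try lia.
by rewrite -[_ ^+ (j - k)]signr_odd -[_ ^+ (j + k)]signr_odd oddB // oddD subrr.
Qed.

Lemma unitmx_orth n (P : 'M[R]_n) c : c != 0 -> P^T *m P = c%:M -> P \in unitmx.
Proof.
move=> c0 e; have /mulmx1_unit[] // : (c^-1 *: P^T) *m P = 1%:M.
by rewrite -scalemxAl e scale_scalar_mx mulVf.
Qed.

Definition path_eigenvalues n : 'rV[R]_n :=
  \row_j (4 * cos (j.+1%:R * pi / n.+1%:R) ^+ 2).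

Lemma skew_path_eigen n : exists2 P : 'M[R]_n, P \in unitmx &
  let T := skew_mx (@path_edges n) in
  T *m T *m P = - (P *m diag_mx (path_eigenvalues n)).
Proof.
(* The eigenvectors are e p * sin ((p + 1) * th j): the sign pattern + + - - of
   e turns the antisymmetric matrix into the symmetric one, up to a shift. *)
pose th (j : nat) : R := j.+1%:R * pi / n.+1%:R.
pose e (p : nat) : R := (-1) ^+ p./2.
have e2 p : e p.+2 = - e p by rewrite /e /= exprS mulN1r.
have ee p : e p * e p = 1 by rewrite -expr2 sqrr_sign.
have sth j : sin (n.+1%:R * th j) = 0.
  have -> : n.+1%:R * th j = j.+1%:R * pi by rewrite /th; field; rewrite addrC natr1 pnatr_eq0.
  by rewrite sin_natmul // sinpi.
(* The shift [k] of the sign pattern grows by one under the matrix: [e p.+2 = - e p] turns the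
   difference of neighbours into sin (y + th) + sin (y - th) = 2 sin y cos th. At both ends the
   missing neighbour has sine 0. *)
have step (k j : nat) (p : 'I_n) :
   \sum_p' skew_mx (@path_edges n) p p' * (e (p' + k)%N * sin (p'.+1%:R * th j)) =
   e (p + k).+1 * sin (p.+1%:R * th j) * (2 * cos (th j)).
  rewrite (sum_skew_path (fun p' => e (p' + k)%N * sin (p'.+1%:R * th j))).
  have -> : (p.+1 < n)%N%:R * (e (p.+1 + k)%N * sin (p.+2%:R * th j)) =
            e (p + k).+1 * sin (p.+2%:R * th j).
    have [pn|] := boolP (p.+1 < n)%N; first by rewrite mul1r addSn.
    rewrite -leqNgt => np; have -> : p.+2 = n.+1 by have := ltn_ord p; lia.
    by rewrite sth !mulr0.
  have -> : (0 < p)%N%:R * (e (p.-1 + k)%N * sin (p.-1.+1%:R * th j)) =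
            - e (p + k).+1 * sin (p%:R * th j).
    case: (posnP p) => [->|p0]; first by rewrite !mul0r sin0 mulr0.
    have -> : (p + k).+1 = (p.-1 + k).+2 by lia.
    by rewrite mul1r prednK // e2 opprK.
  have -> : p.+2%:R * th j = p.+1%:R * th j + th j by rewrite -[p.+2%:R]natr1 mulrDl mul1r.
  have -> : p%:R * th j = p.+1%:R * th j - th j by rewrite -[p.+1%:R]natr1 mulrDl mul1r addrK.
  by rewrite sinD sinB; ring.
pose P k : 'M[R]_n := \matrix_(p, j) (e (p + k)%N * sin (p.+1%:R * th j)).
have PT k : skew_mx (@path_edges n) *m P k = P k.+1 *m diag_mx (\row_j (2 * cos (th j))).
  apply/matrixP => p j; rewrite mul_mx_diag !mxE addnS -step.
  by apply: eq_bigr => p' _; rewrite !mxE.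
exists (P 0%N).
  apply: (@unitmx_orth _ _ (n.+1%:R / 2)).
    by rewrite mulf_neq0 ?invr_eq0 ?pnatr_eq0.
  apply/matrixP => j k; rewrite !mxE.
  have := @sum_sin_orth n.+1 j.+1 k.+1; rewrite !ltnS /= !ltn_ord => /(_ isT isT).
  (* The orthogonality sum has n + 1 terms; its first one is zero and the others are the n rows. *)
  rewrite big_ord_recl /= !mul0r sin0 mul0r add0r eqSS => <-.
  by apply: eq_bigr => p _; rewrite !mxE mulrACA ee mul1r.
(* Two applications shift the pattern by two, that is, change the sign. *)
have P2 : P 2%N = - P 0%N.
  by apply/matrixP => p j; rewrite !mxE addn2 e2 addn0 mulNr.
rewrite /= -mulmxA PT mulmxA PT P2 -mulmxA mulNmx mulmx_diag; congr (- (_ *m diag_mx _)).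
by apply/rowP => j; rewrite !mxE /th; ring.
Qed.

Definition cycle_eigenvalues n : 'rV[R]_n :=
  \row_j (4 * sin ((2 * j + 1)%N%:R * pi / n%:R) ^+ 2).

Lemma skew_cycle_eigen n : (1 < n)%N -> exists2 P : 'M[R]_n, P \in unitmx &
  let T := skew_mx (@cycle_edges n) in
  T *m T *m P = - (P *m diag_mx (cycle_eigenvalues n)).
Proof.
(* The wrap-around edge goes from 1 to n, so eigenvectors extend to antiperiodic
   functions; cos + sin gives a real orthogonal basis of them. *)
move=> n1; have n0 : n%:R != 0 :> R by rewrite pnatr_eq0; lia.
pose th (j : nat) : R := (2 * j + 1)%N%:R * pi / n%:R.
have nth (j : nat) : n%:R * th j = pi + (pi *+ 2) *+ j.
  by rewrite /th -[_ *+ j]mulr_natl natrD natrM -[pi *+ 2]mulr_natl; field.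
have sin_shift p j : sin ((p + n)%N%:R * th j) = - sin (p%:R * th j).
  by rewrite natrD mulrDl nth addrA (periodicn (@sinD2pi R)) sinDpi.
have cos_shift p j : cos ((p + n)%N%:R * th j) = - cos (p%:R * th j).
  by rewrite natrD mulrDl nth addrA (periodicn (@cosD2pi R)) cosDpi.
(* For s = 1 or -1 the matrix sends [f s] to [f (- s)] times 2 s sin th, so its square multiplies
   [f s] by - 4 sin^2 th. *)
pose f (s : R) (j p : nat) := cos (p%:R * th j) + s * sin (p%:R * th j).
have step s j (p : 'I_n) : s ^+ 2 = 1 ->
   \sum_p' skew_mx (@cycle_edges n) p p' * f s j p' = f (- s) j p * (s * (2 * sin (th j))).
  move=> s2.
  rewrite sum_skew_cycle //; last first.
    by rewrite /f -[n in cos (n%:R * _)]add0n -[n in sin (n%:R * _)]add0n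
       sin_shift cos_shift mulrN opprD.
  have fS q : f s j q.+1 = f s j q * cos (th j) + s * f (- s) j q * sin (th j).
    rewrite /f -[q.+1%:R]natr1 mulrDl mul1r cosD sinD.
    apply/subr0_eq; transitivity ((s ^+ 2 - 1) * (sin (q%:R * th j) * sin (th j))); first by ring.
    by rewrite s2 subrr mul0r.
  have fP q : f s j q = f s j q.+1 * cos (th j) - s * f (- s) j q.+1 * sin (th j).
    have eq : q%:R * th j = q.+1%:R * th j - th j by rewrite -[q.+1%:R]natr1 mulrDl mul1r addrK.
    rewrite [in LHS]/f eq cosB sinB /f.
    apply/subr0_eq; transitivity ((1 - s ^+ 2) * (sin (q.+1%:R * th j) * sin (th j))); first by ring.
    by rewrite s2 subrr mul0r.
  rewrite -addrA.
  have -> : (p == 0 :> nat)%:R * f s j n.-1 - (0 < p)%N%:R * f s j p.-1 =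
      - (f s j p * cos (th j) - s * f (- s) j p * sin (th j)).
    case: (posnP p) => [->|p0]; last first.
      by rewrite mul0r mul1r sub0r (fP p.-1) prednK.
    rewrite mul1r mul0r subr0 (fP n.-1) prednK; last by lia.
    rewrite /f -[n in cos (n%:R * _)]add0n -[n in sin (n%:R * _)]add0n sin_shift cos_shift.
    by ring.
  by rewrite fS; ring.
(* The product is cos (a - b) + sin (a + b), where a and b are the two angles. The sine sum always
   vanishes, and the cosine sum vanishes unless j = k. *)
have orth j k : (j < n)%N -> (k < n)%N ->
    \sum_(p < n) f 1 j p * f 1 k p = n%:R *+ (j == k).
  wlog lekj : j k / (k <= j)%N => [hw hj hk|jn kn].
    have [/hw->//|/ltnW/hw h] := leqP k j.
    by rewrite eq_sym -h //; apply: eq_bigr => p _; rewrite mulrC.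
  pose t1 : R := (j - k)%N%:R * pi / n%:R.
  pose t2 : R := (j + k + 1)%N%:R * pi / n%:R.
  have -> : \sum_(p < n) f 1 j p * f 1 k p =
     \sum_(p < n) cos (0 + p%:R * (2 * t1)) + \sum_(p < n) sin (p%:R * (2 * t2)).
    rewrite -big_split; apply: eq_bigr => p _ /=.
    have -> : 0 + p%:R * (2 * t1) = p%:R * th j - p%:R * th k.
      by rewrite /t1 /th natrB // !natrD; ring.
    have -> : p%:R * (2 * t2) = p%:R * th j + p%:R * th k.
      by rewrite /t2 /th !natrD; ring.
    by rewrite cosB sinD /f; ring.
  rewrite (@sum_sin_period n (j + k + 1)) ?addr0; last by rewrite /t2 divfK.
  have [jk|jk] := eqVneq j k.
    rewrite /t1 jk subnn; under eq_bigr do rewrite !mul0r !mulr0 addr0 cos0.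
    by rewrite sumr_const card_ord.
  rewrite (@sum_cos_period n (j - k)) //; first by rewrite /t1 divfK.
  by apply: sin_frac_neq0; lia.
pose P s : 'M[R]_n := \matrix_(p, j) f s j p.
have PT s : s ^+ 2 = 1 -> skew_mx (@cycle_edges n) *m P s =
    P (- s) *m diag_mx (\row_j (s * (2 * sin (th j)))).
  move=> s2; apply/matrixP => p j; rewrite mul_mx_diag !mxE -step //.
  by apply: eq_bigr => p' _; rewrite !mxE.
exists (P 1).
  apply: (@unitmx_orth _ _ n%:R) => //.
  apply/matrixP => j k; rewrite !mxE -(orth j k) //.
  by apply: eq_bigr => p _; rewrite !mxE.
rewrite /= -mulmxA PT ?expr1n // mulmxA PT ?sqrrN ?expr1n // opprK -mulmxA mulmx_diag.
rewrite -mulmxN -linearN; congr (_ *m diag_mx _).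
by apply/rowP => j; rewrite !mxE /th; ring.
Qed.

Lemma path_edges_sym n (p p' : 'I_n) : path_edges p p' = path_edges p' p.
Proof. by rewrite /path_edges orbC. Qed.

Lemma cycle_edges_sym n (p p' : 'I_n) : cycle_edges p p' = cycle_edges p' p.
Proof. by rewrite /cycle_edges path_edges_sym orbC. Qed.

Lemma path_edges_odd n (p p' : 'I_n) : (0 < path_edges p p')%N -> odd p' = ~~ odd p.
Proof. by rewrite /path_edges lt0b => /orP[] /eqP <-; rewrite //= negbK. Qed.

(** Evenness of [n] makes the wrap-around edge join indices of opposite parity. *)
Lemma cycle_edges_odd n (p p' : 'I_n) : ~~ odd n ->
  (0 < cycle_edges p p')%N -> odd p' = ~~ odd p.
Proof.
move=> n2; rewrite /cycle_edges addn_gt0 => /orP[/path_edges_odd //|].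
have := ltn_ord p; have := ltn_ord p'.
by rewrite lt0b => ? ? /orP[] /andP[/eqP e1 /eqP e2]; lia.
Qed.

Lemma tr_alt_mx n : (alt_mx n)^T = alt_mx n.
Proof. by rewrite /alt_mx tr_diag_mx. Qed.

Lemma alt_mx_sqr n : alt_mx n *m alt_mx n = 1%:M.
Proof.
rewrite mulmx_diag -diag_const_mx; congr diag_mx; apply/rowP => p.
by rewrite !mxE -expr2 sqrr_sign.
Qed.

Lemma alt_skew_mx n (e : 'I_n -> 'I_n -> nat) :
  (forall p p', (0 < e p p')%N -> odd p' = ~~ odd p) ->
  alt_mx n *m skew_mx e = - (skew_mx e *m alt_mx n).
Proof.
move=> e_odd; apply/matrixP => p p'; rewrite mul_diag_mx mxE [RHS]mxE mul_mx_diag !mxE.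
have [e0|/e_odd odd_p'] := posnP (e p p'); first by rewrite e0 !mulr0n mulr0 mul0r oppr0.
rewrite -[(-1) ^+ p]signr_odd -[(-1) ^+ p']signr_odd odd_p' mulrC -mulrN.
by case: odd; rewrite ?opprK.
Qed.

Lemma tr_skew_mx n (e : 'I_n -> 'I_n -> nat) : (forall p, e p p = 0%N) ->
  (forall p p', e p p' = e p' p) -> (skew_mx e)^T = - skew_mx e.
Proof.
move=> e0 esym; apply/matrixP => p p'; rewrite !mxE esym -mulNrn.
by case: ltngtP => [||/val_inj->]; rewrite ?opprK // e0 !mulr0n.
Qed.

End LocalMatrices.

(** * The partition function of a bipartite graph as a determinant *)

Section FintypeDeterminant.
Variables (R : comPzRingType) (T : finType).

Definition rank_perm (s : {perm T}) : {perm 'I_#|T|} :=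
  perm (inj_comp enum_rank_inj (inj_comp (@perm_inj _ s) enum_val_inj)).

Lemma rank_permE s v : rank_perm s (enum_rank v) = enum_rank (s v).
Proof. by rewrite permE /= enum_rankK. Qed.

(** Parity depends only on the size of the set and the number of orbits, and [enum_rank] carries
    orbits to orbits. *)
Lemma odd_rank_perm s : odd_perm (rank_perm s) = odd_perm s.
Proof.
rewrite /odd_perm card_ord; congr (_ (+) odd _).
have iter_rank i v : (rank_perm s ^+ i)%g (enum_rank v) = enum_rank ((s ^+ i)%g v).
  by rewrite !permX; elim: i => //= i ->; rewrite rank_permE.
have -> : porbits (rank_perm s) = (fun O : {set T} => enum_rank @: O) @: porbits s.
  rewrite /porbits -imset_comp; apply/setP => O; apply/imsetP/imsetP => -[v _ ->].
    exists (enum_val v) => //=; apply/setP => w.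
   rewrite -[w]enum_valK mem_imset //; last exact: enum_rank_inj.
    rewrite -[v in LHS]enum_valK; apply/porbitP/porbitP => -[i e]; exists i.
      by apply: enum_rank_inj; rewrite e iter_rank.
    by rewrite iter_rank e.
  exists (enum_rank v) => //=; apply/setP => w.
   rewrite -[w]enum_valK mem_imset //; last exact: enum_rank_inj.
  apply/porbitP/porbitP => -[i e]; exists i.
    by rewrite iter_rank e.
  by apply: enum_rank_inj; rewrite e iter_rank.
rewrite card_imset // => A B; exact: (imset_inj enum_rank_inj).
Qed.

Lemma det_fintype (K : T -> T -> R) :
  \det (\matrix_(u, v < #|T|) K (enum_val u) (enum_val v)) =
  \sum_(s : {perm T}) (-1) ^+ s * \prod_v K v (s v).
Proof.
rewrite /determinant (reindex rank_perm); last first.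
  pose unrank (s : 'S_#|T|) : {perm T} :=
    perm (inj_comp enum_val_inj (inj_comp (@perm_inj _ s) enum_rank_inj)).
  apply: onW_bij; exists unrank => s; apply/permP => v.
    by rewrite permE /= rank_permE enum_rankK.
  by rewrite -[v]enum_valK rank_permE permE /= !enum_valK.
apply: eq_bigr => s _; rewrite odd_rank_perm; congr (_ * _).
rewrite (reindex (@enum_rank T)) /=; last exact/onW_bij/enum_rank_bij.
by apply: eq_bigr => v _; rewrite mxE rank_permE !enum_rankK.
Qed.
End FintypeDeterminant.

(** * Configurations as permutations *)

Section LoopVertexDeterminant.
Variables (T : finType) (R : comPzRingType).
Variables (adj arr : rel T) (x : T -> R) (a : T -> T -> R).
Variable col : T -> bool.
Hypothesis adj_col : forall u v, adj u v -> col v = ~~ col u.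

Implicit Types (s : {perm T}) (O : {set T}) (F : {set {set T * T}}).

Lemma adj_neq u v : adj u v -> v != u.
Proof. by move=> /adj_col e; apply: contra_eq_neq e => ->; case: col. Qed.

Lemma bipartite_cycle_even c : path.cycle adj c -> ~~ odd (size c).
Proof.
have col_last v p : path adj v p -> col (last v p) = col v (+) odd (size p).
  elim: p v => [|w p IH] v /=; first by rewrite addbF.
  by case/andP=> /adj_col e /IH ->; rewrite e addNb addbN.
case: c => //= v p /col_last; rewrite last_rcons size_rcons /=.
by case: odd => //; case: col.
Qed.

Definition loop_of s O : {set T * T} := [set (v, s v) | v in O].

(** Fixed points become isolated vertices, 2-cycles doubled edges, and a longer cycle and its
    inverse the two directions of a loop. *)
Definition loops s : {set {set T * T}} :=
  [set loop_of s O | O in [set O in porbits s | (1 < #|O|)%N]].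

Definition admissible s := [forall v, (s v == v) || adj v (s v)].

Lemma porbit_gt1 s v : (1 < #|porbit s v|)%N = (s v != v).
Proof.
apply/idP/idP => [|sv].
  apply: contraTneq => sv; rewrite -leqNgt.
  apply/card_le1P => w /porbitP[i ->] u; rewrite inE.
  apply/porbitP/eqP => [[j ->]|->]; first by rewrite !permX_fix.
  by exists i.
apply/card_gt1P; exists v, (s v); split; rewrite 1?eq_sym ?porbit_id //.
by rewrite -[s v]/((s ^+ 1)%g v) mem_porbit.
Qed.

Lemma loop_vertices_of s O : loop_vertices (loop_of s O) = O.
Proof. by rewrite /loop_vertices -imset_comp imset_id. Qed.

(** The arcs of all loops form the graph of [s] off its fixed points, so [s] can be recovered from
    them. *)
Lemma mem_cover_loops s v w :
  ((v, w) \in cover (loops s)) = (s v != v) && (w == s v).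
Proof.
apply/bigcupP/andP => [[L /imsetP[O]]|[sv /eqP->]].
  rewrite inE => /andP[/imsetP[u _ ->] O1] -> /imsetP[v' uv' [-> ->]].
  by rewrite -porbit_gt1 -(eqP (_ : porbit s u == porbit s v')) ?O1 ?eq_porbit_mem // porbit_sym.
exists (loop_of s (porbit s v)); last by apply: imset_f; rewrite porbit_id.
by apply: imset_f; rewrite inE porbit_gt1 sv imset_f.
Qed.

Lemma loops_inj : injective loops.
Proof.
move=> s t e; apply/permP => v.
have es w : ((v, w) \in cover (loops t)) = (s v != v) && (w == s v).
  by rewrite -e mem_cover_loops.
have := es (s v); have := es (t v); rewrite !mem_cover_loops !eqxx !andbT.
case: (eqVneq (t v) v) => [->|_] /=; case: (eqVneq (s v) v) => [->|_] //=.
by move=> /esym/eqP->.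
Qed.

Lemma loop_of_cycle s c v : uniq c -> (forall w, w \in c -> s w = next c w) ->
  v \in c -> loop_of s (porbit s v) = arcs c.
Proof.
move=> uc sc vc.
have cs : fcycle s c.
  by apply: cycle_from_next => // w wc; rewrite /= sc.
have pc : porbit s v =i c.
  move=> w; rewrite -(fconnect_cycle cs vc); apply/porbitP/idP => [[i ->]|vw].
    by rewrite permX fconnect_iter.
  by exists (findex s v w); rewrite permX iter_findex.
apply/setP => e; apply/imsetP/imsetP => -[w wc ->]; exists w; rewrite -?pc // ?pc //.
  by rewrite sc // -pc.
by rewrite sc.
Qed.

Lemma admissible_cycle s v : admissible s -> s v != v ->
  let c := traject s v #|porbit s v| in
  [/\ (1 < size c)%N, ~~ odd (size c), uniq c, path.cycle adj c
    & loop_of s (porbit s v) = arcs c].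
Proof.
move=> /forallP ok sv c.
have uc : uniq c by rewrite uniq_traject_porbit.
have cs : fcycle s c.
  have := iter_porbit s v; rewrite /c.
  case: #|_| (card_porbit_neq0 s v) => //= k _; rewrite -iterS iterSr => e.
  by have := fpath_traject s v k.+1; rewrite trajectSr e.
have next_c w : w \in c -> next c w = s w by move=> wc; rewrite (nextE cs).
have adj_c : path.cycle adj c.
  apply: cycle_from_next => // w wc; rewrite next_c //.
  (* A fixed point in the orbit of [v] would force [v] itself to be fixed. *)
  have /orP[/eqP sw|//] := ok w.
  have := wc; rewrite -porbit_traject => /porbitP[i e].
  have : (s ^+ i)%g (s v) = (s ^+ i)%g v by rewrite -e -permM -expgS expgSr permM -e.
  by move/perm_inj/eqP; rewrite (negPf sv).
split=> //.
- by rewrite size_traject porbit_gt1.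
- exact: bipartite_cycle_even adj_c.
- apply: loop_of_cycle => // [w wc|]; first by rewrite next_c.
  by rewrite -porbit_traject porbit_id.
Qed.

Lemma loopsP s L : reflect (exists2 v, s v != v & L = loop_of s (porbit s v)) (L \in loops s).
Proof.
apply: (iffP imsetP) => [[O]|[v sv ->]].
  rewrite inE => /andP[/imsetP[v _ ->] O1] ->; exists v => //.
  by rewrite -porbit_gt1.
by exists (porbit s v) => //; rewrite inE porbit_gt1 sv imset_f.
Qed.

Lemma admissible_config s : admissible s -> is_config adj (loops s).
Proof.
move=> ok; split=> [L /loopsP[v sv ->]|L L' /loopsP[v sv ->] /loopsP[w sw ->]].
  by have [] := admissible_cycle ok sv; exists (traject s v #|porbit s v|).
rewrite !loop_vertices_of => vw; apply/pred0P => u /=; apply: contraNF vw => /andP[].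
by rewrite -!eq_porbit_mem => /eqP <- /eqP ->.
Qed.

Lemma loop_vertices_arcs (c : seq T) v : (v \in loop_vertices (arcs c)) = (v \in c).
Proof.
rewrite /loop_vertices -imset_comp; apply/imsetP/idP => [[w wc ->] //|vc].
by exists v.
Qed.

(** The permutation follows the arcs of [F] and fixes the isolated vertices; disjointness of the
    loops makes it well defined and injective. *)
Lemma config_loops F : is_config adj F -> exists2 s, admissible s & loops s = F.
Proof.
move=> [Floop Fdisj].
have same_loop L L' v : L \in F -> L' \in F -> v \in loop_vertices L ->
    v \in loop_vertices L' -> L = L'.
  move=> LF LF' vL vL'; apply/eqP; apply: contraTT vL' => LL'.
  by rewrite (disjointFr (Fdisj _ _ LF LF' LL') vL).
pose f v := if [pick e in cover F | e.1 == v] is Some e then e.2 else v.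
have f_loop c v : arcs c \in F -> v \in c -> f v = next c v.
  move=> cF vc; rewrite /f; case: pickP => [[v' w] /= /andP[/bigcupP[L LF eL] /eqP vv']|].
    subst v'; have vL : v \in loop_vertices L by apply/imsetP; exists (v, w).
    have Lc : L = arcs c by apply: (same_loop _ _ v) => //; rewrite loop_vertices_arcs.
    by move: eL; rewrite Lc => /imsetP[u _ [-> ->]].
  move/(_ (v, next c v)); rewrite /= eqxx andbT => /negP[].
  by apply/bigcupP; exists (arcs c) => //; apply: imset_f.
have f_out v : (forall L, L \in F -> v \notin loop_vertices L) -> f v = v.
  move=> out; rewrite /f; case: pickP => // -[v' w] /= /andP[/bigcupP[L LF eL] /eqP vv'].
  by case/negP: (out L LF); apply/imsetP; exists (v', w).
have in_or_out v : (exists c, [/\ arcs c \in F, uniq c, path.cycle adj c & v \in c]) \/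
    (forall L, L \in F -> v \notin loop_vertices L).
  have [/existsP[L /andP[LF vL]]|] := boolP [exists L in F, v \in loop_vertices L].
    left; have [c [_ _ uc cc Lc]] := Floop L LF; exists c.
    by split; rewrite -?Lc // -loop_vertices_arcs -Lc.
  by rewrite negb_exists_in => /forall_inP; right.
have f_inj : injective f.
  move=> u v fuv.
  (* A common image on a loop forces both points onto that same loop, where [next] is injective. *)
  have key u' v' : f u' = f v' ->
     (exists c, [/\ arcs c \in F, uniq c, path.cycle adj c & u' \in c]) -> u' = v'.
    move=> e [c [cF uc cc uc']]; have fu := f_loop _ _ cF uc'.
    have fc : f v' \in c by rewrite -e fu mem_next.
    have vc : v' \in c.
      have [[c' [cF' uc'' cc' vc']]|out] := in_or_out v'.
        have : arcs c = arcs c'.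
          apply: (same_loop _ _ (f v')) => //; rewrite loop_vertices_arcs //.
          by rewrite (f_loop _ _ cF' vc') mem_next.
        by rewrite -!loop_vertices_arcs => ->; rewrite loop_vertices_arcs.
      by move: fc; rewrite f_out.
    by apply: (can_inj (prev_next uc)); rewrite -fu e (f_loop _ _ cF vc).
  case: (in_or_out u) => [hu|uo]; first exact: key fuv hu.
  case: (in_or_out v) => [hv|vo]; first by apply/esym/key.
  by rewrite -(f_out _ uo) -(f_out _ vo).
exists (perm f_inj).
  apply/forallP => v; rewrite permE.
  have [[c [cF uc cc vc]]|/f_out->] := in_or_out v; last by rewrite eqxx.
  by rewrite (f_loop _ _ cF vc) (next_cycle cc vc) orbT.
have loop_f c v : arcs c \in F -> uniq c -> v \in c ->
    loop_of (perm f_inj) (porbit (perm f_inj) v) = arcs c.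
  move=> cF uc vc; apply: loop_of_cycle => // w wc.
  by rewrite permE (f_loop _ _ cF wc).
apply/setP => L; apply/loopsP/idP => [[v]|LF].
  rewrite permE; have [[c [cF uc cc vc]] _ ->|/f_out->] := in_or_out v; last by rewrite eqxx.
  by rewrite (loop_f c).
have [[|v c] [c2 _ uc cc Lc]] := Floop L LF; first by [].
have vc : v \in v :: c by rewrite mem_head.
exists v; last by rewrite (loop_f (v :: c)) // -Lc.
by rewrite permE (f_loop (v :: c)) -?Lc //; apply/adj_neq/(next_cycle cc vc).
Qed.

Definition loop_vertex_matrix u v : R :=
  if u == v then x u else if adj u v then sgn R arr u v * a u v else 0.
Local Notation K := loop_vertex_matrix.

Lemma sign_porbits s : (-1) ^+ s = \prod_(O in porbits s) (-1) ^+ #|O|.+1 :> R.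
Proof.
have -> : \prod_(O in porbits s) (-1) ^+ #|O|.+1 =
    (-1) ^+ (\sum_(O in porbits s) #|O| + #|porbits s|) :> R.
  rewrite -sum1_card -big_split /= -prodrXr.
  by apply: eq_bigr => O _; rewrite addn1.
have -> : (\sum_(O in porbits s) #|O|)%N = #|T|.
  rewrite -sum1_card (partition_big_imset (porbit s)) /=.
  apply: eq_bigr => _ /imsetP[v _ ->]; rewrite -sum1_card.
  by apply: eq_bigl => w; rewrite eq_porbit_mem porbit_sym.
by rewrite -[RHS]signr_odd oddD.
Qed.

(** A cycle of even length has sign - 1, which is the minus sign in [loop_weight]; fixed points
    contribute the vertex weights. *)
Lemma admissible_weight s : admissible s ->
  (-1) ^+ s * \prod_v K v (s v) = config_weight arr x a (loops s).
Proof.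
move=> ok; have ok' := forallP ok.
rewrite (bigID (fun v => s v != v)) /= mulrA /config_weight; congr (_ * _); last first.
  apply: eq_big => [v|v]; last by rewrite negbK /K => /eqP ->; rewrite eqxx.
  rewrite negbK; apply/eqP/forall_inP => [sv L /loopsP[w sw ->]|out].
    rewrite loop_vertices_of -eq_porbit_mem; apply: contraNN sw => /eqP e.
    by rewrite -[_ == _]negbK -porbit_gt1 -e porbit_gt1 sv eqxx.
  apply/eqP; apply: contraT => sv.
  have := out (loop_of s (porbit s v)); rewrite loop_vertices_of porbit_id.
  by move=> h; apply: h; apply/loopsP; exists v.
rewrite /loops big_imset => [|O O' _ _ /(congr1 (@loop_vertices T))]; last first.
  by rewrite !loop_vertices_of.
rewrite sign_porbits (bigID (fun O => (1 < #|O|)%N)) /= [X in _ * X * _]big1 ?mulr1; last first.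
  move=> O /andP[/imsetP[v _ ->]]; rewrite -leqNgt => O1.
  have -> : #|porbit s v| = 1%N.
    by apply/eqP; rewrite eqn_leq O1 lt0n card_porbit_neq0.
  by rewrite sqrrN expr1n.
rewrite (partition_big (porbit s) (fun O => (O \in porbits s) && (1 < #|O|)%N)) /=; last first.
  by move=> v sv; rewrite porbit_gt1 sv imset_f.
rewrite -big_split /= [RHS](eq_bigl (fun O => (O \in porbits s) && (1 < #|O|)%N)); last first.
  by move=> O; rewrite inE.
apply: eq_bigr => _ /andP[/imsetP[v _ ->]]; rewrite porbit_gt1 => sv.
have [_ + _ _ _] := admissible_cycle ok sv; rewrite size_traject => /negPf even_orbit.
rewrite -signr_odd /= even_orbit expr1 mulN1r /loop_weight; congr (- _).
rewrite big_imset => [|u w _ _ [] //] /=.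
apply: eq_big => [w|w /andP[sw _]].
  rewrite eq_porbit_mem porbit_sym andb_idl // => vw.
  by rewrite -porbit_gt1; move: vw; rewrite -eq_porbit_mem => /eqP <-; rewrite porbit_gt1.
have := ok' w; rewrite (negPf sw) /= => adj_w.
by rewrite /K eq_sym (negPf sw) adj_w.
Qed.

Lemma partition_function_det :
  partition_function adj arr x a =
  \det (\matrix_(u, v < #|T|) K (enum_val u) (enum_val v)).
Proof.
rewrite det_fintype (bigID admissible) /= addrC big1 ?add0r; last first.
  move=> s; rewrite negb_forall => /existsP[v]; rewrite negb_or => /andP[sv nadj].
  by rewrite (bigD1 v) //= /K eq_sym (negPf sv) (negPf nadj) mul0r mulr0.
rewrite (eq_bigr _ (fun s ok => admissible_weight ok)).
rewrite -(big_imset _ (in2W loops_inj)) /partition_function.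
apply: eq_bigl => F; apply/asboolP/imsetP => [/config_loops[s ok <-]|[s ok ->]].
  by exists s.
exact: admissible_config.
Qed.

End LoopVertexDeterminant.

(** * Boustrophedon signs *)

Section Labels.
Local Open Scope nat_scope.
Implicit Types (n u v : nat -> nat).

Lemma boustrophedonSS n v d : boustrophedon n v d.+2 =
  if odd (v d.+1) then (v d.+1 - 1) * \prod_(i < d.+1) n i + boustrophedon n v d.+1
  else (v d.+1 - 1) * \prod_(i < d.+1) n i + \prod_(i < d.+1) n i + 1 - boustrophedon n v d.+1.
Proof. by []. Qed.

Local Arguments boustrophedon : simpl never.

(** Hence the layers of the last coordinate occupy disjoint intervals of labels. *)
Lemma boustrophedon_bounds n v d : (forall i, i < d.+1 -> 0 < v i <= n i) ->
  0 < boustrophedon n v d.+1 <= \prod_(i < d.+1) n i.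
Proof.
elim: d => [|d IH] hv; first by rewrite big_ord1; apply: hv.
rewrite big_ord_recr boustrophedonSS /=.
have := IH (fun i hi => hv i (ltnW hi)); have := hv d.+1 (ltnSn _).
move: (\prod_(i < d.+1) n i) (boustrophedon _ _ _) (v d.+1) (n d.+1) => N L p k.
move=> /andP[p0 pk] /andP[L0 LN].
have pE : (p - 1) * N + N = p * N by rewrite -mulSnr subn1 prednK.
have : p * N <= N * k by rewrite mulnC leq_mul2l pk orbT.
by move: ((p - 1) * N) (p * N) (N * k) pE => pN1 pN Nk; case: odd; lia.
Qed.

(* Each even layer above coordinate q reverses the order of the labels below it;
   coordinates start at 1, so even layers have odd (u i).-1. *)
Lemma boustrophedon_lt n u v d q :
  (forall i, i < d -> 0 < u i <= n i) -> (forall i, i < d -> 0 < v i <= n i) ->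
  q < d -> u q < v q -> (forall i, i < d -> i != q -> u i = v i) ->
  if odd (\sum_(q.+1 <= i < d) (u i).-1)
  then boustrophedon n v d < boustrophedon n u d
  else boustrophedon n u d < boustrophedon n v d.
Proof.
elim: d => [//|d IH] hu hv qd uvq uv; case: d => [|d] in IH hu hv qd uv *.
  by rewrite big_geq //=; move: qd uvq; rewrite ltnS leqn0 => /eqP->.
have hu' i (hi : i < d.+1) := hu i (ltnW hi).
have hv' i (hi : i < d.+1) := hv i (ltnW hi).
have := boustrophedon_bounds hu'; have := boustrophedon_bounds hv'.
(* If [q] is the last coordinate, the layers alone decide. Otherwise both vertices share a layer,
   which keeps or reverses the inductive order. *)
rewrite !boustrophedonSS; have [qd'|dq] := ltnP q d.+1; last first.
  have qE : q = d.+1 by lia.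
  rewrite qE in uvq *; rewrite big_geq //=.
  move: (\prod_(i < d.+1) n i) (boustrophedon _ u _) (boustrophedon _ v _) uvq => N L L'.
  have := hu d.+1 (ltnSn _).
  by move: (u d.+1) (v d.+1) => p p'; case: (odd p); case: (odd p'); nia.
rewrite [\sum_(_ <= i < d.+2) _]big_nat_recr //= oddD -(uv d.+1) //; last by lia.
have := IH hu' hv' qd' uvq (fun i hi => uv i (ltnW hi)).
have := hu d.+1 (ltnSn _).
move: (\prod_(i < d.+1) n i) (boustrophedon _ u _) (boustrophedon _ v _) => N L L'.
move: (u d.+1) (odd (\sum_(_ <= i < _) _)) => p b /andP[p0 _].
have -> : odd p.-1 = ~~ odd p by lia.
by case: b; case: (odd p) => /=; lia.
Qed.
End Labels.

(** * The signed adjacency matrix of the cylinder as a tensor sum *)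

Section CylinderMatrix.
Variables (d : nat) (m : 'I_d -> nat).
Hypothesis m_gt0 : forall q, (0 < m q)%N.
Implicit Types (u v : grid m).

Lemma extend0E (f : 'I_d -> nat) (q : 'I_d) : extend0 f q = f q.
Proof. by rewrite /extend0 valK. Qed.

Lemma extend0_lt (f : 'I_d -> nat) i (hi : (i < d)%N) : extend0 f i = f (Ordinal hi).
Proof. exact: (extend0E f (Ordinal hi)). Qed.

Lemma cyl_edges_id q (p : 'I_(2 * m q)) : cyl_edges p p = 0%N.
Proof.
have := m_gt0 q; have pE : path_edges p p = 0%N by rewrite /path_edges; lia.
rewrite /cyl_edges; case: ifP => _ //; rewrite /cycle_edges pE; lia.
Qed.

Lemma cyl_edges_sym q (p p' : 'I_(2 * m q)) : cyl_edges p p' = cyl_edges p' p.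
Proof.
by rewrite /cyl_edges; case: ifP => _; [apply: cycle_edges_sym | apply: path_edges_sym].
Qed.

Lemma cyl_edges_odd q (p p' : 'I_(2 * m q)) :
  (0 < cyl_edges p p')%N -> odd p' = ~~ odd p.
Proof.
rewrite /cyl_edges; case: ifP => _; last exact: path_edges_odd.
by apply: cycle_edges_odd; rewrite mul2n odd_double.
Qed.

Definition grid_color u : bool := odd (\sum_q u q).

Lemma cyl_adj_color u v : cyl_adj u v -> grid_color v = ~~ grid_color u.
Proof.
case/existsP=> q; rewrite /box_edges; case: ifP => //.
move=> /andP[_ /forall_inP uv] /cyl_edges_odd odd_v.
rewrite /grid_color (bigD1 q) //= [in RHS](bigD1 q) //= !oddD odd_v addNb.
congr (~~ (_ (+) odd _)).
by apply: eq_bigr => r rq; rewrite (eqP (uv r rq)).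
Qed.

Lemma label_lt u v q : (u q < v q)%N -> (forall r, r != q -> u r = v r) ->
  if odd (\sum_(r < d | (q < r)%N) u r) then (label v < label u)%N
  else (label u < label v)%N.
Proof.
move=> uvq uv.
have := @boustrophedon_lt (extend0 (fun q => 2 * m q)%N) (extend0 (fun q => (u q).+1))
  (extend0 (fun q => (v q).+1)) d q.
rewrite big_geq_mkord.
under eq_bigr do rewrite extend0E /=.
rewrite -/(label u) -/(label v); apply => // [i hi|i hi||i hi].
- by rewrite !extend0_lt /=.
- by rewrite !extend0_lt /=.
- by rewrite !extend0E.
- by rewrite !extend0_lt => iq; rewrite uv.
Qed.

Section Entries.
Variables (R : realType) (x : R) (a : 'I_d -> R).
Let T q : 'M[R]_(2 * m q) := skew_mx R (@cyl_edges d m q).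
Let J q : 'M[R]_(2 * m q) := alt_mx R (2 * m q).

(** The diagonal factors force [u] and [v] to agree off [q]. The factors [J] then give the parity of
    the later coordinates and [T q] the order of [u q] and [v q]; together these are the
    boustrophedon orientation. *)
Lemma tail_factor_prod q u v :
  \prod_r tail_factor T J q r (u r) (v r) =
  sgn R (cyl_arr (m := m)) u v *+ box_edges (cyl_edges (m := m)) q u v.
Proof.
rewrite /box_edges; case: ifP => [/andP[uvq /forall_inP uv]|]; last first.
  move=> /negbT; rewrite negb_and negbK => /orP[/eqP uvq|].
    by rewrite (bigD1 q) //= /tail_factor ltnn eqxx uvq mxE cyl_edges_id !mulr0n mul0r.
  rewrite negb_forall_in => /exists_inP[r rq uvr].
  rewrite (bigD1 r) //= /tail_factor (negPf rq).
  by case: ifP => _; rewrite !mxE (negPf uvr) mulr0n mul0r.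
have prodE : \prod_r tail_factor T J q r (u r) (v r) =
    (-1) ^+ (\sum_(r < d | (q < r)%N) u r) * T q (u q) (v q).
  rewrite (bigD1 q) //= {1}/tail_factor ltnn eqxx mulrC; congr (_ * _).
  rewrite (bigID (fun r : 'I_d => (q < r)%N)) /= [X in _ * X]big1 ?mulr1.
    rewrite -prodrXr; apply: eq_big => [r|r /andP[rq qr]].
      by rewrite andb_idl // => qr; rewrite -val_eqE gt_eqF.
    rewrite /tail_factor ltnNge (ltnW qr) (negPf rq) /= !mxE -(eqP (uv r rq)) eqxx mulr1n.
    by [].
  move=> r /andP[rq qr]; have rq' : (r < q)%N.
    by rewrite ltn_neqAle leqNgt qr andbT.
  by rewrite /tail_factor rq' !mxE (eqP (uv r rq)) eqxx.
rewrite prodE mxE.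
have [e0|e_gt0] := posnP (cyl_edges (u q) (v q)); first by rewrite e0 !mulr0n mulr0.
rewrite mulrnAr; congr (_ *+ _).
have adj_uv : cyl_adj u v.
  by apply/existsP; exists q; rewrite /box_edges uvq; case: ifP => // /negP[]; apply/forall_inP.
have uv' r : r != q -> u r = v r by move=> /uv/eqP.
rewrite /sgn /cyl_arr adj_uv /= -signr_odd.
case: (ltngtP (u q) (v q)) => [lt_uv|lt_vu|/val_inj e]; last by rewrite e eqxx in uvq.
  have := label_lt lt_uv uv'; case: odd => [h|->]; rewrite ?expr1 ?mulr1 //.
  by rewrite ltnNge ltnW.
(* The endpoints are exchanged here; the later coordinates agree, so the parity is unchanged. *)
have := label_lt lt_vu (fun r rq => esym (uv' r rq)).
rewrite (eq_bigr (fun r => u r : nat)) => [|r qr]; last by rewrite uv' // -val_eqE gt_eqF.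
by case: odd => [->|h]; rewrite ?expr1 ?mulrNN ?mulr1 // ?mul1r ltnNge ltnW.
Qed.

Lemma cyl_matrix :
  \matrix_(u, v < #|grid m|) loop_vertex_matrix (cyl_adj (m := m)) (cyl_arr (m := m))
     (fun=> x) (box_weight (cyl_edges (m := m)) a) (enum_val u) (enum_val v) =
  x%:M + tail_sum T J a.
Proof.
apply/matrixP => u v; rewrite !mxE summxE.
under [in RHS]eq_bigr do rewrite !mxE tail_factor_prod.
rewrite -(inj_eq enum_val_inj) /loop_vertex_matrix.
move: (enum_val u) (enum_val v) => {}u {}v.
have [->|uv] := eqVneq u v.
  by rewrite big1 ?addr0 // => q _; rewrite /box_edges eqxx mulr0n mulr0.
rewrite mulr0n add0r; case: ifP => [_|/negbT].
  by rewrite /box_weight mulr_sumr; apply: eq_bigr => q _; rewrite mulrnAr mulrC -mulrnAr.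
rewrite negb_exists => /forallP nadj; rewrite big1 // => q _.
by have := nadj q; rewrite -eqn0Ngt => /eqP ->; rewrite mulr0n mulr0.
Qed.
End Entries.
End CylinderMatrix.

(** * Folding the spectrum *)

Section Folding.
Variables (d : nat) (m : 'I_d -> nat).

Fact fold_ord_proof n (p : 'I_(2 * n)) :
  ((if (p < n)%N then p : nat else 2 * n - p.+1) < n)%N.
Proof. by have p_lt := ltn_ord p; case: (ltnP p n) => //; lia. Qed.

(** Identifies p with 2 n - 1 - p, the reflection under which the local spectra are invariant. *)
Definition fold_ord n (p : 'I_(2 * n)) : 'I_n := Ordinal (fold_ord_proof p).

Lemma card_fold_ord n (i : 'I_n) : #|[pred p | fold_ord p == i]| = 2%N.
Proof.
have i_lt : (i < 2 * n)%N by have := ltn_ord i; lia.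
have i'_lt : (2 * n - i.+1 < 2 * n)%N by have := ltn_ord i; lia.
transitivity #|[set Ordinal i_lt; Ordinal i'_lt]|; last first.
  by rewrite cards2 -val_eqE /=; have := ltn_ord i; lia.
apply: eq_card => p; rewrite !inE -!val_eqE /=.
have p_lt := ltn_ord p; have i_n := ltn_ord i; apply/idP/idP; case: (ltnP p n); lia.
Qed.

Definition fold_grid (u : grid m) : {dffun forall q : 'I_d, 'I_(m q)} :=
  [ffun q => fold_ord (u q)].

(** A fibre is a product of [d] two-element sets. *)
Lemma card_fold_grid i : #|[pred u | fold_grid u == i]| = (2 ^ d)%N.
Proof.
pose F (q : 'I_d) : pred 'I_(2 * m q) := [pred p | fold_ord p == i q].
transitivity #|(family F : simpl_pred (grid m))|.
  apply: eq_card => u; rewrite !inE; apply/eqP/familyP => [e q|h].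
    by rewrite /F !inE -e ffunE.
  by apply/ffunP => q; rewrite ffunE; apply/eqP/h.
rewrite card_family foldrE big_image /=.
by rewrite (eq_bigr (fun=> 2%N)) ?prod_nat_const ?card_ord // => q _; apply: card_fold_ord.
Qed.

Lemma prod_fold_grid (R : comPzRingType) (G : {dffun forall q : 'I_d, 'I_(m q)} -> R) :
  \prod_(u : grid m) G (fold_grid u) = \prod_i G i ^+ (2 ^ d).
Proof.
rewrite (partition_big fold_grid predT) //=; apply: eq_bigr => i _.
rewrite (eq_bigr (fun=> G i)) => [|u /eqP-> //].
by rewrite prodr_const card_fold_grid.
Qed.
End Folding.

(** * The spectrum of the cylinder and the product formula *)

Section Eigenvalues.
Variables (R : realType) (d : nat) (m : 'I_d -> nat).
Hypothesis m_gt0 : forall q, (0 < m q)%N.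
Variables (a : 'I_d -> R).

Definition cyl_eigenvalues (q : 'I_d) : 'rV[R]_(2 * m q) :=
  if q == 0%N :> nat then cycle_eigenvalues R (2 * m q) else path_eigenvalues R (2 * m q).

Lemma cyl_eigen (q : 'I_d) : exists2 P : 'M[R]_(2 * m q), P \in unitmx &
  let T := skew_mx R (@cyl_edges d m q) in
  T *m T *m P = - (P *m diag_mx (cyl_eigenvalues q)).
Proof.
rewrite /cyl_edges /cyl_eigenvalues; case: ifP => _; last exact: skew_path_eigen.
by apply: skew_cycle_eigen; have := m_gt0 q; lia.
Qed.

Variable hd : (0 < d)%N.

Definition cyl_factor (i : {dffun forall q : 'I_d, 'I_(m q)}) : R :=
  4 * a (Ordinal hd) ^+ 2
         * sin ((2 * (i (Ordinal hd)).+1 - 1)%N%:R * pi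
                / (2 * m (Ordinal hd))%N%:R) ^+ 2
     + \sum_(q < d | (0 < q)%N)
         4 * a q ^+ 2
           * cos ((i q).+1%:R * pi / (2 * m q + 1)%N%:R) ^+ 2.

Lemma cos_reflect (n k : nat) : (k <= n)%N ->
  cos ((n - k)%N%:R * pi / n%:R) ^+ 2 = cos (k%:R * pi / n%:R) ^+ 2 :> R.
Proof.
case: n => [|n] kn; first by rewrite !invr0 !mulr0.
have -> : (n.+1 - k)%N%:R * pi / n.+1%:R = - (k%:R * pi / n.+1%:R) + pi :> R.
  by rewrite natrB //; field; rewrite addrC natr1 pnatr_eq0.
by rewrite cosDpi cosN sqrrN.
Qed.

Lemma sin_reflect (n k : nat) : (k <= 2 * n)%N ->
  sin ((2 * n - k)%N%:R * pi / n%:R) ^+ 2 = sin (k%:R * pi / n%:R) ^+ 2 :> R.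
Proof.
case: n => [|n] kn; first by rewrite !invr0 !mulr0.
have -> : (2 * n.+1 - k)%N%:R * pi / n.+1%:R = - (k%:R * pi / n.+1%:R) + pi *+ 2 :> R.
  by rewrite natrB // natrM -[pi *+ 2]mulr_natl; field; rewrite addrC natr1 pnatr_eq0.
by rewrite sinD2pi sinN sqrrN.
Qed.

Lemma cyl_eigenvalue_fold (u : grid m) :
  tail_eigenvalue a cyl_eigenvalues u = cyl_factor (fold_grid u).
Proof.
rewrite /tail_eigenvalue /cyl_factor (bigD1 (Ordinal hd)) //=; congr (_ + _).
  rewrite /cyl_eigenvalues eqxx mxE ffunE /= mulrCA mulrA; congr (_ * _).
  move: (u (Ordinal hd)) => p; have p_lt := ltn_ord p.
  case: ltnP => h; first by congr (sin (_%:R * _ / _) ^+ 2); lia.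
  (* The reflected frequency is 4 m - (2 p + 1) = 2 (2 m - p) - 1, and 2 m - p is the folded index
     counted from 1. *)
  rewrite -sin_reflect; last by lia.
  by congr (sin (_%:R * _ / _) ^+ 2); lia.
apply: eq_big => q; first by rewrite -val_eqE /= lt0n.
rewrite -val_eqE /= => /negPf q0; rewrite /cyl_eigenvalues q0 mxE ffunE /= mulrCA mulrA.
rewrite addn1; congr (_ * _); move: (u q) => p; have p_lt := ltn_ord p.
case: (ltnP p (m q)) => // h; rewrite -cos_reflect; last by lia.
by congr (cos (_%:R * _ / _) ^+ 2); lia.
Qed.
End Eigenvalues.

(* The tuple i lists the indices i_q counted from 0, so i_q in the usual
   numbering is (i q).+1; Ordinal hd is the first coordinate direction. *)
Theorem theorem3p2 (R : realType) (d : nat) (hd : (0 < d)%N)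
  (m : 'I_d -> nat) (hm : forall q : 'I_d, (0 < m q)%N)
  (x : R) (a : 'I_d -> R) :
  cyl_partition_function m x a =
  \prod_(i : {dffun forall q : 'I_d, 'I_(m q)})
    (x ^+ 2
     + 4 * a (Ordinal hd) ^+ 2
         * sin ((2 * (i (Ordinal hd)).+1 - 1)%N%:R * pi
                / (2 * m (Ordinal hd))%N%:R) ^+ 2
     + \sum_(q < d | (0 < q)%N)
         4 * a q ^+ 2
           * cos ((i q).+1%:R * pi / (2 * m q + 1)%N%:R) ^+ 2)
    ^+ (2 ^ (d - 1)).
Proof.
rewrite /cyl_partition_function (partition_function_det _ _ _ (@cyl_adj_color _ m)).
rewrite cyl_matrix //.
have [Phi Phi_unit Phi_eigen] := fin_all_exists2 (cyl_eigen R hm).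
(* The claimed product as a polynomial in x. *)
pose Q : {poly R} := \prod_(i : {dffun forall q : 'I_d, 'I_(m q)})
  ('X^2 + (cyl_factor a hd i)%:P) ^+ (2 ^ (d - 1)).
have Q_monic : Q \is monic.
  apply: monic_prod => i _; apply: monic_exp.
  by rewrite monicE lead_coefDl ?lead_coefXn // size_polyXn size_polyC; case: eqP.
rewrite (det_tail_sum _ _ _ _ Phi_unit Phi_eigen x Q_monic).
- rewrite horner_prod; apply: eq_bigr => i _.
  by rewrite horner_exp hornerD hornerXn hornerC /cyl_factor addrA.
- by move=> q; apply: alt_mx_sqr.
- by move=> q; apply: alt_skew_mx => p p'; apply: cyl_edges_odd.
- by move=> q; apply: tr_alt_mx.
- by move=> q; apply: tr_skew_mx => [p|p p']; rewrite ?cyl_edges_id // cyl_edges_sym.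
under eq_bigr do rewrite cyl_eigenvalue_fold.
(* Folding yields the exponent 2^d, which is twice 2^(d - 1) because d > 0; so the full product is
   the square of [Q]. *)
rewrite (prod_fold_grid (fun i => 'X^2 + (cyl_factor a hd i)%:P)) /Q -prodrXl.
by apply: eq_bigr => i _; rewrite -exprM -expnSr subn1 prednK.
Qed.
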